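(* Let $X$ be a determinantal random subset of $S$ associated with the subspace $\operatorname{im} d$ in the orthonormal basis $(e_i^\star/\sqrt{x_i})_{i\in S}$ of $E^*$, and let $K$ be a subset of $S$ containing a basis of $\mathcal M$ (so that $\mathbb P(X\subseteq K)>0$). For every basis $T$ of $\mathcal M$ contained in $K$, $$\mathbb P\big(X=T\,\big|\,X\subseteq K\big)=\frac{\underline x^{-(K\setminus T)}}{\|\mathscr Z^K_T\|^2}.$$
   Context: Let $\mathbb K=\mathbb R$ or $\mathbb C$, $S=\{1,\dots,s\}$, $E$ an $s$-dimensional $\mathbb K$-vector space with basis $(e_i)_{i\in S}$, $F$ a finite-dimensional $\mathbb K$-vector space, and $\partial:E\to F$ a linear map. Let $\mathcal M$ be the linear matroid on $S$ whose independent sets are the $I\subseteq S$ such that $\{\partial(e_i):i\in I\}$ is linearly independent; $Z=\ker\partial$. For $J\subseteq S$, $E_J=\mathrm{Vect}(e_j:j\in J)$, and $Z_K=Z\cap E_K$. For a basis $T$ of $\mathcal M$ one has $E=E_T\oplus Z$, and $\mathsf Z_T:E\to Z$ is the corresponding projection. If $T\subseteq K$, $\mathscr Z^K_T=(\mathsf Z_T(e_j):j\in K\setminus T)$, ordered by the order of $S$, is a basis of $Z_K$. The dual spaces $E^*$ and $F^*$ are inner product spaces (antilinear in the first variable), and the dual basis $(e_i^\star)_{i\in S}$ of $E^*$ is orthogonal, with $\langle e_i^\star,e_j^\star\rangle=x_i\delta_{ij}$ for positive weights $(x_i)_{i\in S}$; $\underline x^I=\prod_{i\in I}x_i$ and $\underline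 x^{-I}=(\underline x^I)^{-1}$. $d:F^*\to E^*$ is the transpose of $\partial$. $J_{\underline x}:E\to E^*$ is the antilinear isomorphism with $J_{\underline x}(e_i)=x_i^{-1}e_i^\star$. For a basis $\mathscr B=(f_1,\dots,f_r)$ of a subspace of $E$, $\|\mathscr B\|^2=\det(\langle J_{\underline x}f_i,J_{\underline x}f_j\rangle)_{1\le i,j\le r}$. Given a finite-dimensional inner product space with an orthonormal basis indexed by a finite set $S$ and a subspace $H$, a random subset $X$ of $S$ is determinantal associated to $H$ in this basis if $\mathbb P(J\subseteq X)=\det((\Pi^H)^J_J)$ for all $J\subseteq S$, where $\Pi^H$ is the orthogonal projection on $H$ and $(\Pi^H)^J_J$ is the submatrix of its matrix in the basis with rows and columns in $J$. *)

(* Defs.v *)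
From HB Require Import structures.
From mathcomp Require Import all_boot all_order all_algebra.
From mathcomp Require Import complex.
From mathcomp Require Import all_classical all_reals all_analysis.

Set Implicit Arguments.
Unset Strict Implicit.
Unset Printing Implicit Defensive.

Import Order.TTheory GRing.Theory Num.Theory.

Local Open Scope ring_scope.

Inductive scalars := RealScalars | ComplexScalars.

Definition scalar_field (R : realType) (k : scalars) : numFieldType :=
  match k with
  | RealScalars => R : numFieldType
  | ComplexScalars => R[i] : numFieldType
  end.

Definition sconj (R : realType) (k : scalars) :
    {rmorphism scalar_field R k -> scalar_field R k} :=
  match k with
  | RealScalars => (@idfun R : {rmorphism R -> R})
  | ComplexScalars => (@conjc R : {rmorphism R[i] -> R[i]})
  end.

Definition of_real (R : realType) (k : scalars) :
    {rmorphism R -> scalar_field R k} :=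
  match k with
  | RealScalars => (@idfun R : {rmorphism R -> R})
  | ComplexScalars => (real_complex R : {rmorphism R -> R[i]})
  end.
Arguments of_real {R} k.

(* The family (f (e_i))_{i in I} is free; in particular, two parallel elements
   i <> j with f (e_i) = f (e_j) are dependent. *)
Definition matroid_indep (K : fieldType) (E F : vectType K) (s : nat)
    (e : s.-tuple E) (f : 'Hom(E, F)) (I : {set 'I_s}) : bool :=
  free [seq f (tnth e i) | i <- enum I].

Definition matroid_basis (K : fieldType) (E F : vectType K) (s : nat)
    (e : s.-tuple E) (f : 'Hom(E, F)) (T : {set 'I_s}) : bool :=
  maxset (matroid_indep e f) T.

Definition coord_space (K : fieldType) (E : vectType K) (s : nat)
    (e : s.-tuple E) (J : {set 'I_s}) : {vspace E} :=
  <<[seq tnth e j | j <- enum J]>>%VS.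

Definition ker_proj (K : fieldType) (E F : vectType K) (s : nat)
    (e : s.-tuple E) (f : 'Hom(E, F)) (T : {set 'I_s}) : 'End(E) :=
  daddv_pi (lker f) (coord_space e T).

Definition ker_family (K : fieldType) (E F : vectType K) (s : nat)
    (e : s.-tuple E) (f : 'Hom(E, F)) (L T : {set 'I_s}) : seq E :=
  [seq ker_proj e f T (tnth e j) | j <- enum (L :\: T)].

Definition dual_basis (K : fieldType) (E : vectType K) (s : nat)
    (e : s.-tuple E) (i : 'I_s) : 'Hom(E, K^o) :=
  linfun (coord e i : E -> K^o).

Definition transpose (K : fieldType) (E F : vectType K) (f : 'Hom(E, F)) :
    'Hom('Hom(F, K^o), 'Hom(E, K^o)) :=
  linfun (fun phi : 'Hom(F, K^o) => (phi \o f)%VF).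

(* [linfun] is only meaningful on linear maps; this lemma and the next one
   rule out junk values. *)
Lemma dual_basisE (K : fieldType) (E : vectType K) (s : nat)
  (e : s.-tuple E) (i : 'I_s) (v : E) : dual_basis e i v = coord e i v.
Proof. by rewrite lfunE. Qed.

Lemma transposeE (K : fieldType) (E F : vectType K) (f : 'Hom(E, F))
  (phi : 'Hom(F, K^o)) : transpose f phi = (phi \o f)%VF.
Proof.
have lin : linear (fun psi : 'Hom(F, K^o) => (psi \o f)%VF).
  by move=> a psi1 psi2; rewrite comp_lfunDl comp_lfunZl.
pose g := HB.pack_for {linear 'Hom(F, K^o) -> 'Hom(E, K^o)}
  (fun psi : 'Hom(F, K^o) => (psi \o f)%VF)
  (GRing.isLinear.Build _ _ _ _ (fun psi : 'Hom(F, K^o) => (psi \o f)%VF) lin).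
exact: (lfunE g phi).
Qed.

(* Library dot products are antilinear in the second variable; here inner
   products are antilinear in the first one. *)
Definition inner (K : numFieldType) (V : lmodType K) (theta : K -> K)
    (dot : {dot V for theta}) (u v : V) : K := dot v u.

(* The antilinear map J_x : E -> E^* such that J_x (e_i) = x_i^-1 e_i^*. *)
Definition weight_map (R : realType) (k : scalars)
    (E : vectType (scalar_field R k)) (s : nat) (e : s.-tuple E)
    (x : 'I_s -> R) (v : E) : 'Hom(E, (scalar_field R k)^o) :=
  \sum_(i < s) sconj R k (coord e i v) *:
    ((of_real k (x i))^-1 *: dual_basis e i).

Definition sqr_norm_family (R : realType) (k : scalars)
    (E : vectType (scalar_field R k))
    (dot : {dot 'Hom(E, (scalar_field R k)^o) for sconj R k})
    (s : nat) (e : s.-tuple E) (x : 'I_s -> R) (B : seq E) : scalar_field R k :=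
  \det (\matrix_(i < size B, j < size B)
          inner dot (weight_map e x B`_i) (weight_map e x B`_j)).

Definition orth_proj (K : numFieldType) (V : vectType K)
    (theta : {rmorphism K -> K}) (dot : {dot V for theta})
    (H : {vspace V}) : 'End(V) :=
  daddv_pi H (orthov dot H).

(* The (i, j) entry is the i-th coordinate of the image of the j-th basis
   vector: matrices act on column vectors, unlike those of [mxof]. *)
Definition mx_in_basis (K : fieldType) (V : vectType K) (s : nat)
    (b : s.-tuple V) (f : 'End(V)) : 'M[K]_s :=
  \matrix_(i, j) coord b i (f (tnth b j)).

Definition principal_submx (K : Type) (s : nat) (M : 'M[K]_s) (J : {set 'I_s}) :
    'M[K]_#|J| :=
  mxsub (fun i => enum_val i) (fun i => enum_val i) M.

Definition normalized_dual_basis (R : realType) (k : scalars)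
    (E : vectType (scalar_field R k)) (s : nat) (e : s.-tuple E)
    (x : 'I_s -> R) : s.-tuple 'Hom(E, (scalar_field R k)^o) :=
  [tuple (of_real k (Num.sqrt (x i)))^-1 *: dual_basis e i | i < s].

Section RandomSubsets.
Local Open Scope classical_set_scope.

Definition random_subset (d : measure_display) (Omega : measurableType d)
    (s : nat) (X : Omega -> {set 'I_s}) : Prop :=
  forall A : {set 'I_s}, measurable [set w | X w = A].

Definition prob (d : measure_display) (Omega : measurableType d)
    (R : realType) (P : probability Omega R) (A : set Omega) : R :=
  fine (P A).

Definition cond_prob (d : measure_display) (Omega : measurableType d)
    (R : realType) (P : probability Omega R) (A B : set Omega) : R :=
  prob P (A `&` B) / prob P B.

(* [b] is meant to be an orthonormal basis of the inner product space [V]. *)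
Definition determinantal (d : measure_display) (Omega : measurableType d)
    (R : realType) (k : scalars) (P : probability Omega R)
    (V : vectType (scalar_field R k)) (dot : {dot V for sconj R k}) (s : nat)
    (b : s.-tuple V) (H : {vspace V}) (X : Omega -> {set 'I_s}) : Prop :=
  forall J : {set 'I_s},
    of_real k (prob P [set w | J \subset X w]) =
    \det (principal_submx (mx_in_basis b (orth_proj dot H)) J).

End RandomSubsets.

(* Main.v *)
(* Let Pi be the orthogonal projection on im d and Q = 1 - Pi, the projection on
   (im d)^perp = J_x(Z).  Inclusion-exclusion gives P(X \subset L) = det Q_(~L),
   and these minors vanish when |L| < |T|, so that P(X = T) = P(X \subset T).
   In the basis (J_x(Z_T e_l))_(l \notin T) of (im d)^perp the block of
   coordinates indexed by ~T is diagonal, because Z_T e_l - e_l lies in E_T.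
   Hence Q_(~T) is, up to the weights, the inverse of the Gram matrix of this
   basis, and Jacobi's identity turns det Q_(~L) / det Q_(~T) into a minor of
   that Gram matrix, which is the squared norm of the family Z_T^L. *)
Require Import Defs.
From mathcomp Require Import all_boot all_order all_algebra.
From mathcomp Require Import perm complex.
From mathcomp Require Import all_classical all_reals all_analysis.

Set Implicit Arguments.
Unset Strict Implicit.
Unset Printing Implicit Defensive.

Import Order.TTheory GRing.Theory Num.Theory.

Local Open Scope ring_scope.

(** * Principal minors and inclusion-exclusion *)

(** Rows and columns undergo the same permutation, whose sign enters squared. The sizes are only
    propositionally equal because the intended [n] is [#|J| + #|~: J|]. *)
Lemma det_mxsub_inj (K : comNzRingType) (n m : nat) (N : 'M[K]_m)
    (h : 'I_n -> 'I_m) :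
  n = m -> injective h -> \det (mxsub h h N) = \det N.
Proof.
move=> nm; case: m / nm N h => N h h_inj.
have -> : mxsub h h N = row_perm (perm h_inj) (col_perm (perm h_inj) N).
  by apply/matrixP => i j; rewrite !mxE !permE.
rewrite row_permE col_permE !det_mulmx !det_perm odd_permV.
by rewrite mulrCA -signr_addb addbb mulr1.
Qed.

(** Listing [J] before its complement, as [h] does, makes [N] block upper triangular with a diagonal
    lower right block. *)
Lemma det_mask (K : comNzRingType) (s : nat) (N : 'M[K]_s) (c : 'I_s -> K)
    (J : {set 'I_s}) :
  (forall i j, i \notin J -> N i j = c i *+ (i == j)) ->
  \det N = (\prod_(i in ~: J) c i) * \det (principal_submx N J).
Proof.
move=> NJ.
pose h (i : 'I_(#|J| + #|~: J|)) :=
  match fintype.split i with inl a => enum_val a | inr b => enum_val b end.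
have h_inj : injective h.
  move=> i j; rewrite /h; case: (splitP i) => a ia; case: (splitP j) => b jb.
  - by move/enum_val_inj=> ab; apply/val_inj; rewrite /= ia jb ab.
  - by move=> ab; have := enum_valP b; rewrite -ab inE enum_valP.
  - by move=> ab; have := enum_valP a; rewrite ab inE enum_valP.
  - by move/enum_val_inj=> ab; apply/val_inj; rewrite /= ia jb ab.
have hs : (#|J| + #|~: J| = s)%N by rewrite cardsC card_ord.
have hl a : h (lshift _ a) = enum_val a by rewrite /h (unsplitK (inl a)).
have hr a : h (rshift _ a) = enum_val a by rewrite /h (unsplitK (inr a)).
rewrite -(det_mxsub_inj N hs h_inj) -[mxsub h h N]submxK.
have -> : dlsubmx (mxsub h h N) = 0.
  apply/matrixP => i j; rewrite !mxE hl hr NJ; last first.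
    by have := enum_valP i; rewrite inE.
  by case: eqP => // ij; have := enum_valP i; rewrite ij inE enum_valP.
have -> : drsubmx (mxsub h h N) = diag_mx (\row_i c (enum_val i)).
  apply/matrixP => i j; rewrite !mxE !hr NJ; last first.
    by have := enum_valP i; rewrite inE.
  by rewrite (inj_eq enum_val_inj).
rewrite det_ublock det_diag mulrC [in RHS]big_enum_val; congr (_ * _).
  by apply: eq_bigr => i _; rewrite mxE.
by congr (\det _); apply/matrixP => i j; rewrite !mxE !hl.
Qed.

Lemma eq_principal_submx (K : Type) (s : nat) (M N : 'M[K]_s)
    (J : {set 'I_s}) :
  {in J &, forall i j, M i j = N i j} -> principal_submx M J = principal_submx N J.
Proof. by move=> MN; apply/matrixP => i j; rewrite !mxE MN ?enum_valP. Qed.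

(** Turns minors of various sizes into determinants of [s] by [s] matrices, so that products and
    multilinearity in the rows apply without changing index types. *)
Lemma det_principal_submx_mask (K : comNzRingType) (s : nat) (N : 'M[K]_s)
    (J : {set 'I_s}) :
  \det (principal_submx N J) =
  \det (\matrix_(i, j) if i \in J then N i j else (i == j)%:R).
Proof.
rewrite (@det_mask _ _ _ (fun=> 1) J) ?big1 // ?mul1r => [|i j /negPf iJ]; last first.
  by rewrite mxE iJ.
by congr (\det _); apply: eq_principal_submx => i j iJ jJ; rewrite mxE iJ.
Qed.

Lemma det_principal_submx_tr (K : comNzRingType) (s : nat) (N : 'M[K]_s)
    (J : {set 'I_s}) :
  \det (principal_submx N^T J) = \det (principal_submx N J).
Proof. by rewrite -det_tr; congr (\det _); apply/matrixP => i j; rewrite !mxE. Qed.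

(* Jacobi's identity for complementary minors of the Gram matrix G and of its
   inverse on ~: T, which Q is up to the scaling d. *)
Lemma minor_identity (K : comNzRingType) (s : nat) (Q Y B G : 'M[K]_s)
    (d : 'I_s -> K) (T L : {set 'I_s}) : T \subset L ->
  Q = Y *m B ->
  (forall l i, i \notin T -> B l i = d i *+ (l == i)) ->
  (forall i l, i \in T -> G i l = 0) ->
  (forall i l, i \notin T -> (Y *m G) i l = d i *+ (i == l)) ->
  \det (principal_submx Q (~: L)) * \det (principal_submx G (~: T)) =
  (\prod_(i in ~: L) d i ^+ 2) * \det (principal_submx G (L :\: T)).
Proof.
move=> /fintype.subsetP TL QYB Bd GT YG.
have LT i : i \notin L -> i \notin T by apply: contra; exact: TL.
(* The columns of [B] outside [L] are diagonal, so the corresponding columns of [Q] are those of [Y]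
   scaled by [d]. *)
have -> : \det (principal_submx Q (~: L)) =
    (\prod_(i in ~: L) d i) * \det (principal_submx Y (~: L)).
  have -> : principal_submx Q (~: L) =
      principal_submx Y (~: L) *m diag_mx (\row_i d (enum_val i)).
    apply/matrixP => i j; rewrite mul_mx_diag !mxE QYB mxE.
    have jL : enum_val j \notin L by have := enum_valP j; rewrite inE.
    rewrite (bigD1 (enum_val j)) //= Bd ?LT// eqxx big1 ?addr0// => l lj.
    by rewrite Bd ?LT// (negPf lj) mulr0.
  rewrite det_mulmx det_diag mulrC [in RHS]big_enum_val; congr (_ * _).
  by apply: eq_bigr => i _; rewrite mxE.
(* The columns in [T] are cleared because [G'] has identity rows there, where [G] has zero rows.
   Thus the rows of [W *m G'] outside [L] agree with those of [Y *m G], which are diagonal. *)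
pose W : 'M[K]_s := \matrix_(i, j)
  if i \in ~: L then if j \in T then 0 else Y i j else (i == j)%:R.
have detW : \det W = \det (principal_submx Y (~: L)).
  rewrite det_principal_submx_mask -[RHS]mul1r.
  have -> : \det W = \det (principal_submx W (~: L)).
    rewrite (@det_mask _ _ W (fun=> 1) (~: L)) ?big1 ?mul1r// => i j /negPf iL.
    by rewrite mxE iL.
  rewrite mul1r -det_principal_submx_mask; congr (\det _).
  apply: eq_principal_submx => i j iL; rewrite inE => /LT/negPf jT.
  by rewrite mxE iL jT.
pose G' : 'M[K]_s := \matrix_(i, j) if i \in ~: T then G i j else (i == j)%:R.
have detWG : \det (W *m G') =
    (\prod_(i in ~: L) d i) * \det (principal_submx G (L :\: T)).
  have WG i j : (W *m G') i j =
      if i \in ~: L then d i *+ (i == j) else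
      if i \in ~: T then G i j else (i == j)%:R.
    case: (boolP (i \in ~: L)) => iL; last first.
      rewrite mxE (bigD1 i)//= big1 ?addr0 => [|l li]; rewrite !mxE (negPf iL).
        by rewrite eqxx mul1r.
      by rewrite eq_sym (negPf li) mul0r.
    rewrite -YG; last by apply: LT; rewrite inE in iL.
    rewrite !mxE; apply: eq_bigr => l _; rewrite !mxE iL inE.
    by case: (boolP (l \in T)) => lT //=; rewrite GT// mul0r mulr0.
  pose c i := if i \in ~: L then d i else 1.
  rewrite (@det_mask _ _ _ c (L :\: T)); last first.
    move=> i j iLT; rewrite WG /c; case: ifP => //; rewrite !inE => iL.
    by move: iLT; rewrite !inE (negbFE iL) andbT => /negbNE ->.
  congr (_ * _).
    rewrite (bigID (mem (~: L))) /= [X in _ * X]big1 ?mulr1.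
      rewrite /c; apply: eq_big => [i|i /andP[_ ->]//].
      rewrite !inE; case: (boolP (i \in L)) => //; first by rewrite andbF.
      by rewrite andbF.
    by rewrite /c => i /andP[_ /negPf ->].
  congr (\det _); apply: eq_principal_submx => i j; rewrite !inE => /andP[iT iL] _.
  by rewrite WG !inE iT iL.
rewrite (det_principal_submx_mask G (~: T)) -/G' -detW -mulrA -det_mulmx detWG.
by rewrite mulrA -big_split.
Qed.

(** The submatrix factors through a space of dimension [#|~: T|], so its rank is smaller than its
    size. *)
Lemma det_principal_submx_mul_eq0 (K : fieldType) (s : nat) (Y B : 'M[K]_s)
    (T J : {set 'I_s}) :
  (forall l i, l \in T -> B l i = 0) -> (#|~: T| < #|J|)%N ->
  \det (principal_submx (Y *m B) J) = 0.
Proof.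
move=> BT ltTJ.
have -> : principal_submx (Y *m B) J =
    (\matrix_(i < #|J|, l < #|~: T|) Y (enum_val i) (enum_val l)) *m
    (\matrix_(l < #|~: T|, j < #|J|) B (enum_val l) (enum_val j)).
  apply/matrixP => i j; rewrite !mxE (bigID (mem (~: T))) /= addrC big1 ?add0r.
    by rewrite [in LHS]big_enum_val; apply: eq_bigr => l _; rewrite !mxE.
  by move=> l; rewrite inE negbK => lT; rewrite BT// mulr0.
apply/eqP; apply: contraTT ltTJ => detN0; rewrite -leqNgt.
have : row_free ((\matrix_(i < #|J|, l < #|~: T|) Y (enum_val i) (enum_val l)) *m
    (\matrix_(l < #|~: T|, j < #|J|) B (enum_val l) (enum_val j))).
  by rewrite row_free_unit unitmxE unitfE.
by move/eqP => <-; exact: mulmx_max_rank.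
Qed.

(* Inclusion-exclusion: rows of M indexed by the avoided elements are replaced
   by those of 1 - M, one at a time. *)
Lemma sum_subset_det (K : comNzRingType) (s : nat) (M : 'M[K]_s)
    (p : {set 'I_s} -> K) :
  (forall J : {set 'I_s}, \sum_(A : {set 'I_s} | J \subset A) p A =
     \det (principal_submx M J)) ->
  forall L : {set 'I_s}, \sum_(A : {set 'I_s} | A \subset L) p A =
    \det (principal_submx (1%:M - M) (~: L)).
Proof.
move=> pM.
pose N (I J : {set 'I_s}) : 'M[K]_s := \matrix_(i, j)
  if i \in I then M i j else if i \in J then (i == j)%:R - M i j else (i == j)%:R.
(* This interpolates between the hypothesis, where [J] is empty, and the goal, where [I] is
   empty. *)
suff H n (I J : {set 'I_s}) : [disjoint I & J] -> #|J| = n ->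
    \sum_(A : {set 'I_s} | (I \subset A) && [disjoint A & J]) p A = \det (N I J).
  move=> L; rewrite det_principal_submx_mask.
  have -> : \sum_(A : {set 'I_s} | A \subset L) p A =
      \sum_(A : {set 'I_s} | (finset.set0 \subset A) && [disjoint A & ~: L]) p A.
    by apply: eq_bigl => A; rewrite finset.sub0set finset.disjoints_subset finset.setCK.
  rewrite (H #|~: L|) //; last by rewrite finset.disjoints_subset finset.sub0set.
  by congr (\det _); apply/matrixP => i j; rewrite !mxE finset.in_set0.
elim: n I J => [|n IHn] I J IJ.
  move/eqP; rewrite cards_eq0 => /eqP ->.
  under eq_bigl => A do rewrite disjoint_sym finset.disjoints_subset finset.sub0set andbT.
  rewrite pM det_principal_submx_mask; congr (\det _); apply/matrixP => i j.
  by rewrite !mxE finset.in_set0.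
move=> Jn; have /card_gt0P[a aJ] : (0 < #|J|)%N by rewrite Jn.
have aI : a \notin I by apply: contraL aJ => /(disjointFr IJ) ->.
have IJa : [disjoint I & J :\ a].
  by apply: disjointWr IJ; exact: subD1set.
have Jan : #|J :\ a| = n by move: Jn; rewrite (cardsD1 a) aJ => -[].
have IaJa : [disjoint a |: I & J :\ a].
  rewrite finset.disjoints_subset finset.subUset finset.sub1set !inE eqxx /=.
  by rewrite -finset.disjoints_subset.
(* Row [a] of [N I J] is an identity row minus row [a] of [M]. This matches removing, from the sets
   that avoid [J :\ a], those that contain [a]. *)
have -> : \det (N I J) = 1 * \det (N I (J :\ a)) + (-1) * \det (N (a |: I) (J :\ a)).
  apply: (@determinant_multilinear _ _ _ _ _ a).
  - apply/matrixP => i j; rewrite !mxE !inE eqxx aJ (negPf aI) /=.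
    by rewrite mul1r mulN1r.
  - apply/matrixP => i j; rewrite !mxE !inE.
    by rewrite eq_sym neq_lift.
  - apply/matrixP => i j; rewrite !mxE !inE.
    by rewrite eq_sym (negPf (neq_lift _ _)).
rewrite -(IHn _ _ IJa Jan) -(IHn _ _ IaJa Jan) mul1r mulN1r.
apply/eqP; rewrite eq_sym subr_eq; apply/eqP.
rewrite (bigID (fun A : {set 'I_s} => a \in A)) /= addrC; congr (_ + _).
  apply: eq_bigl => A; rewrite -andbA; congr (_ && _).
  rewrite -[in RHS](finset.setD1K aJ) ![[disjoint A & _]]disjoint_sym.
  rewrite [in RHS]finset.disjoints_subset finset.subUset finset.sub1set inE.
  by rewrite -finset.disjoints_subset andbC.
apply: eq_bigl => A; rewrite finset.subUset finset.sub1set.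
by rewrite andbAC [_ && (a \in A)]andbC.
Qed.

(** * Orthogonal complements *)

(** Each linear form cuts the dimension by at most one. The complement [orthov dot H] unfolds to an
    intersection of [\dim H] such kernels. *)
Lemma leq_dim_bigcap_lker (K : fieldType) (V : vectType K) (n : nat)
    (f : 'I_n -> 'Hom(V, K^o)) :
  (\dim {:V} <= n + \dim (\bigcap_(i < n) lker (f i)))%N.
Proof.
elim: n f => [|n IHn] f; first by rewrite big_ord0.
rewrite big_ord_recr /= addSn.
set A := (\bigcap_(i < n) _)%VS.
apply: leq_trans (IHn (fun i => f (widen_ord (leqnSn n) i))) _; rewrite -/A.
rewrite -addnS leq_add2l -(limg_ker_dim (f ord_max) A) -addn1 leq_add2l.
by rewrite (leq_trans (dimvS (subvf _))) // dimvf.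
Qed.

Lemma capv_orthov (K : numFieldType) (V : vectType K)
    (theta : {rmorphism K -> K}) (dot : {dot V for theta}) (H : {vspace V}) :
  (H :&: orthov dot H = 0)%VS.
Proof.
apply/eqP; rewrite -subv0; apply/subvP => u; rewrite memv_cap => /andP[uH uO].
rewrite memv0; apply: contraT => /(neq0_dnorm_gt0 (s := dot)).
by rewrite (mem_orthovP (form := dot) uO) // ltxx.
Qed.

Lemma addv_orthov (K : numFieldType) (V : vectType K)
    (theta : {rmorphism K -> K}) (dot : {dot V for theta}) (H : {vspace V}) :
  (H + orthov dot H = fullv)%VS.
Proof.
apply/eqP; rewrite eqEdim subvf dimv_disjoint_sum ?capv_orthov //=.
exact: leq_dim_bigcap_lker.
Qed.

(** * The splitting of [E] along a matroid basis and the projection on the kernel *)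

(** By rank-nullity on the span: its image already has dimension [size X], which leaves nothing for
    the kernel. *)
Lemma capv_lker_span (K : fieldType) (V W : vectType K) (f : 'Hom(V, W))
    (X : seq V) : free [seq f v | v <- X] -> (lker f :&: <<X>> = 0)%VS.
Proof.
move=> fX; apply/eqP; rewrite -dimv_eq0 capvC.
have := limg_ker_dim f <<X>>; rewrite limg_span => XX.
have := dim_span X; rewrite -XX (eqnP fX) size_map.
by rewrite -leqn0 -[X in (_ <= X)%N]add0n leq_add2r.
Qed.

Lemma capv_lker_coord_space (K : fieldType) (E F : vectType K) (s : nat)
    (e : s.-tuple E) (f : 'Hom(E, F)) (T : {set 'I_s}) :
  matroid_basis e f T -> (lker f :&: coord_space e T = 0)%VS.
Proof. by move=> /maxsetp; rewrite /matroid_indep map_comp => /capv_lker_span. Qed.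

(** For [j] outside [T], maximality forces the image of [e_j] into the span of the images of the
    [e_i] with [i] in [T]. Subtracting a preimage in [E_T] leaves an element of the kernel. *)
Lemma addv_lker_coord_space (K : fieldType) (E F : vectType K) (s : nat)
    (e : s.-tuple E) (f : 'Hom(E, F)) (T : {set 'I_s}) :
  basis_of {:E} e -> matroid_basis e f T ->
  (lker f + coord_space e T = fullv)%VS.
Proof.
move=> he /maxsetP[Ti Tmax]; apply/eqP; rewrite eqEsubv subvf /=.
rewrite -(span_basis he); apply/span_subvP => _ /tnthP[j ->].
have [jT|jT] := boolP (j \in T).
  apply: subvP (addvSr _ _) _ _; apply: memv_span; apply: map_f.
  by rewrite mem_enum.
have : f (tnth e j) \in <<[seq f (tnth e i) | i <- enum T]>>%VS.
  apply: contraT => fj.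
  have : matroid_indep e f (j |: T).
    have pe : perm_eq (enum (j |: T)) (j :: enum T).
      apply: uniq_perm; rewrite /= ?enum_uniq ?mem_enum ?jT // => i.
      by rewrite !inE !mem_enum !inE.
    by rewrite /matroid_indep (perm_free (perm_map _ pe)) /= free_cons fj.
  move=> /Tmax -/(_ (finset.subsetUr _ _)) TT.
  by move: jT; rewrite -TT !inE eqxx.
rewrite map_comp -limg_span => /memv_imgP[u uX fu].
by rewrite -(subrK u (tnth e j)) memv_add // memv_ker linearB /= fu subrr.
Qed.

Lemma ker_proj_id (K : fieldType) (E F : vectType K) (s : nat)
    (e : s.-tuple E) (f : 'Hom(E, F)) (T : {set 'I_s}) (v : E) :
  matroid_basis e f T -> f v = 0 -> ker_proj e f T v = v.
Proof.
move=> hT fv; apply: daddv_pi_id; first exact: capv_lker_coord_space.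
by rewrite memv_ker fv.
Qed.

Lemma ker_projB (K : fieldType) (E F : vectType K) (s : nat)
    (e : s.-tuple E) (f : 'Hom(E, F)) (T : {set 'I_s}) (v : E) :
  basis_of {:E} e -> matroid_basis e f T ->
  v - ker_proj e f T v \in coord_space e T.
Proof.
move=> he hT.
have := @daddv_pi_add _ _ (lker f) (coord_space e T) v.
move=> /(_ (capv_lker_coord_space hT)).
rewrite addv_lker_coord_space // memvf => /(_ isT) {1}<-.
by rewrite addrC addKr memv_pi.
Qed.

Lemma ker_projK (K : fieldType) (E F : vectType K) (s : nat)
    (e : s.-tuple E) (f : 'Hom(E, F)) (T : {set 'I_s}) (v : E) :
  f (ker_proj e f T v) = 0.
Proof. by apply/eqP; rewrite -memv_ker memv_pi. Qed.

(** Lets the family of the projected [e_l] be indexed by the whole ground set, with zeros on [T]. *)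
Lemma ker_proj_basis0 (K : fieldType) (E F : vectType K) (s : nat)
    (e : s.-tuple E) (f : 'Hom(E, F)) (T : {set 'I_s}) (i : 'I_s) :
  basis_of {:E} e -> matroid_basis e f T -> i \in T ->
  ker_proj e f T (tnth e i) = 0.
Proof.
move=> he hT iT; apply/eqP.
rewrite -memv0 -(capv_lker_coord_space hT) memv_cap memv_ker ker_projK eqxx.
rewrite -(subKr (tnth e i) (ker_proj e f T _)) memvB ?ker_projB//.
by apply: memv_span; apply: map_f; rewrite mem_enum.
Qed.

Lemma coord_tnth (K : fieldType) (E : vectType K) (s : nat) (e : s.-tuple E)
    (i j : 'I_s) : basis_of {:E} e -> coord e i (tnth e j) = (i == j)%:R.
Proof.
move=> he; rewrite (tnth_nth 0) coord_free ?(basis_free he) //.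
by rewrite eq_sym.
Qed.

Lemma coord_coord_space (K : fieldType) (E : vectType K) (s : nat)
    (e : s.-tuple E) (T : {set 'I_s}) (i : 'I_s) (v : E) :
  basis_of {:E} e -> v \in coord_space e T -> i \notin T -> coord e i v = 0.
Proof.
move=> he vT iT; apply/eqP.
pose g : 'Hom(E, K^o) := linfun (coord e i : E -> K^o).
suff /subvP/(_ _ vT) : (coord_space e T <= lker g)%VS by rewrite memv_ker lfunE.
apply/span_subvP => _ /mapP[j + ->]; rewrite mem_enum => jT.
rewrite memv_ker lfunE /= coord_tnth //.
by have /negPf -> : i != j by apply: contraNneq iT => ->.
Qed.

Lemma coord_ker_proj (K : fieldType) (E F : vectType K) (s : nat)
    (e : s.-tuple E) (f : 'Hom(E, F)) (T : {set 'I_s}) (i j : 'I_s) :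
  basis_of {:E} e -> matroid_basis e f T -> i \notin T ->
  coord e i (ker_proj e f T (tnth e j)) = (i == j)%:R.
Proof.
move=> he hT iT; have := coord_coord_space he (ker_projB (tnth e j) he hT) iT.
by rewrite linearB /= coord_tnth // => /eqP; rewrite subr_eq0 => /eqP <-.
Qed.

(** * Gram determinants, dual bases and the weight map *)

(** With entries given on naturals, an equality of sizes can be substituted without casting
    ordinals. *)
Lemma det_nat_matrix (K : comNzRingType) (n m : nat) (g : nat -> nat -> K) :
  n = m -> \det (\matrix_(i < n, j < n) g i j) = \det (\matrix_(i < m, j < m) g i j).
Proof. by move->. Qed.

Lemma det_matrix_map_enum (K : comNzRingType) (U : Type) (u0 : U) (s : nat)
    (h : 'I_s -> U) (g : U -> U -> K) (J : {set 'I_s})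
    (B := [seq h j | j <- enum J]) :
  \det (\matrix_(i < size B, j < size B) g (nth u0 B i) (nth u0 B j)) =
  \det (principal_submx (\matrix_(i, j) g (h i) (h j)) J).
Proof.
have szB : size B = #|J| by rewrite size_map -cardE.
rewrite (det_nat_matrix (fun i j => g (nth u0 B i) (nth u0 B j)) szB).
congr (\det _); apply/matrixP => i j; rewrite !mxE.
by rewrite !(nth_map (enum_default i)) -?cardE // -!enum_val_nth.
Qed.

Lemma sconj_of_real (R : realType) (k : scalars) (a : R) :
  sconj R k (of_real k a) = of_real k a.
Proof. by case: k => //=; rewrite oppr0. Qed.

Lemma sconjK (R : realType) (k : scalars) : involutive (sconj R k).
Proof. by case: k => // a; exact: conjcK. Qed.

Lemma dual_basis_tnth (K : fieldType) (E : vectType K) (s : nat)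
    (e : s.-tuple E) (i j : 'I_s) :
  basis_of {:E} e -> dual_basis e i (tnth e j) = (i == j)%:R.
Proof. by move=> he; rewrite dual_basisE coord_tnth. Qed.

Lemma dual_basis_sum (K : fieldType) (E : vectType K) (s : nat)
    (e : s.-tuple E) (phi : 'Hom(E, K^o)) : basis_of {:E} e ->
  phi = \sum_i phi (tnth e i) *: dual_basis e i.
Proof.
move=> he; apply/lfunP => v; rewrite {1}(coord_basis he (memvf v)) linear_sum.
rewrite sum_lfunE; apply: eq_bigr => i _.
rewrite linearZ scale_lfunE dual_basisE /= (tnth_nth 0).
exact: mulrC.
Qed.

Lemma dot_nondegenerate (K : numFieldType) (V : lmodType K)
    (theta : {rmorphism K -> K}) (dot : {dot V for theta}) (u v : V) :
  (forall w, dot w u = dot w v) -> u = v.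
Proof.
move=> uv; apply/eqP; rewrite -subr_eq0; apply: contraT.
by move/(neq0_dnorm_gt0 (s := dot)); rewrite linearBr /= uv subrr ltxx.
Qed.

(** The weight map is the Riesz identification of [E] with its dual: pairing with the image of [v]
    is evaluation at [v]. On [e_j^*] the weight [x_j] cancels the factor [x_j^-1]. *)
Lemma dot_weight_map (R : realType) (k : scalars) (s : nat)
    (E : vectType (scalar_field R k)) (e : s.-tuple E) (x : 'I_s -> R)
    (dotE : {dot 'Hom(E, (scalar_field R k)^o) for sconj R k})
    (phi : 'Hom(E, (scalar_field R k)^o)) (v : E) :
  basis_of {:E} e -> (forall i, 0 < x i) ->
  (forall i j, inner dotE (dual_basis e i) (dual_basis e j) =
     if i == j then of_real k (x i) else 0) ->
  dotE phi (weight_map e x v) = phi v.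
Proof.
move=> he hx hdot.
rewrite (dual_basis_sum phi he) linear_sumlz sum_lfunE; apply: eq_bigr => j _.
rewrite linearZl_LR scale_lfunE dual_basisE; congr (_ * _).
rewrite /weight_map linear_sumr (bigD1 j) //= big1 ?addr0 => [|i ij].
  rewrite !linearZr /= sconjK -[dotE _ _]/(inner dotE (dual_basis e j) _).
  rewrite hdot eqxx -fmorphV sconj_of_real -rmorphM mulVf ?gt_eqF//.
  by rewrite rmorph1 mulr1.
rewrite !linearZr /= -[dotE _ _]/(inner dotE (dual_basis e i) _) hdot.
by rewrite (negPf ij) !mulr0.
Qed.

Lemma weight_map_tnth (R : realType) (k : scalars) (s : nat)
    (E : vectType (scalar_field R k)) (e : s.-tuple E) (x : 'I_s -> R)
    (v : E) (i : 'I_s) : basis_of {:E} e ->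
  weight_map e x v (tnth e i) = sconj R k (coord e i v) / of_real k (x i).
Proof.
move=> he; rewrite sum_lfunE (bigD1 i) //= big1 ?addr0 => [|j ji].
  by rewrite !scale_lfunE dual_basis_tnth// eqxx; congr (_ * _); exact: mulr1.
by rewrite !scale_lfunE dual_basis_tnth// (negPf ji) !scaler0.
Qed.

Lemma of_real_sqrt_neq0 (R : realType) (k : scalars) (a : R) :
  0 < a -> of_real k (Num.sqrt a) != 0.
Proof. by move=> a0; rewrite fmorph_eq0 gt_eqF// sqrtr_gt0. Qed.

Lemma nth_normalized_dual_basis (R : realType) (k : scalars) (s : nat)
    (E : vectType (scalar_field R k)) (e : s.-tuple E) (x : 'I_s -> R)
    (i : 'I_s) :
  (normalized_dual_basis e x)`_i =
  (of_real k (Num.sqrt (x i)))^-1 *: dual_basis e i.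
Proof. by rewrite -tnth_nth tnth_mktuple. Qed.

Lemma normalized_dual_basis_free (R : realType) (k : scalars) (s : nat)
    (E : vectType (scalar_field R k)) (e : s.-tuple E) (x : 'I_s -> R) :
  basis_of {:E} e -> (forall i, 0 < x i) -> free (normalized_dual_basis e x).
Proof.
move=> he hx; apply/freeP => a a0 i.
have /lfunP/(_ (tnth e i)) := a0.
rewrite sum_lfunE zero_lfunE (bigD1 i) //= big1 => [|j ji].
  rewrite addr0 nth_normalized_dual_basis !scale_lfunE dual_basis_tnth// eqxx.
  move/eqP; rewrite !scaler_eq0 oner_eq0 orbF => /orP[/eqP//|].
  by rewrite invr_eq0 (negPf (of_real_sqrt_neq0 _ (hx i))).
rewrite nth_normalized_dual_basis !scale_lfunE dual_basis_tnth//.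
by rewrite (negPf ji) !scaler0.
Qed.

Lemma coord_normalized_dual_basis (R : realType) (k : scalars) (s : nat)
    (E : vectType (scalar_field R k)) (e : s.-tuple E) (x : 'I_s -> R)
    (phi : 'Hom(E, (scalar_field R k)^o)) (i : 'I_s) :
  basis_of {:E} e -> (forall i, 0 < x i) ->
  coord (normalized_dual_basis e x) i phi =
  phi (tnth e i) * of_real k (Num.sqrt (x i)).
Proof.
move=> he hx; rewrite {1}(dual_basis_sum phi he).
rewrite (eq_bigr (fun j => (phi (tnth e j) * of_real k (Num.sqrt (x j))) *:
    (normalized_dual_basis e x)`_j)) => [|j _].
  by rewrite coord_sum_free ?normalized_dual_basis_free.
rewrite nth_normalized_dual_basis scalerA mulfK //.
exact: of_real_sqrt_neq0.
Qed.

(** * Factorization of the projection on the complement of [im d] *)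

(** Supplies the data of [minor_identity]. Row [i] of [Y] holds coefficients of [(1 - Pi) b_i] on
    the [w l], hence the transpose. The entries of [Y] times the Gram matrix are the products of
    [(1 - Pi) b_i] with [w l], where [b_i] may replace [(1 - Pi) b_i] since [w l] is orthogonal to
    [im d]. *)
Lemma compl_proj_factor (R : realType) (k : scalars) (s : nat)
    (E F : vectType (scalar_field R k)) (e : s.-tuple E) (del : 'Hom(E, F))
    (x : 'I_s -> R)
    (dotE : {dot 'Hom(E, (scalar_field R k)^o) for sconj R k})
    (T : {set 'I_s})
    (b := normalized_dual_basis e x)
    (w := fun l => weight_map e x (ker_proj e del T (tnth e l))) :
  basis_of {:E} e -> (forall i, 0 < x i) ->
  (forall i j, inner dotE (dual_basis e i) (dual_basis e j) =
     if i == j then of_real k (x i) else 0) ->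
  matroid_basis e del T ->
  exists2 Y : 'M[scalar_field R k]_s,
    (1%:M - mx_in_basis b (orth_proj dotE (limg (transpose del))))^T =
      Y *m (\matrix_(l, i) coord b i (w l)) &
    forall i l, i \notin T ->
      (Y *m \matrix_(l, j) dotE (w l) (w j)) i l =
      (of_real k (Num.sqrt (x i)))^-1 *+ (i == l).
Proof.
move=> he hx hdot hT.
have dotw phi l : dotE phi (w l) = phi (ker_proj e del T (tnth e l)).
  exact: dot_weight_map.
set H := limg (transpose del).
pose pi := orth_proj dotE H.
pose q i := tnth b i - pi (tnth b i).
have qO i : q i \in orthov dotE H.
  rewrite /q -{1}(daddv_pi_add (capv_orthov dotE H) (w := tnth b i)).
    by rewrite addrC addKr memv_pi.
  by rewrite addv_orthov memvf.
have dot_q_H i phi : phi \in H -> dotE phi (q i) = 0.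
  move=> phiH; apply/eqP; rewrite herm_eq0C.
  by rewrite (mem_orthovP (form := dotE) (qO i)).
(* [z i] is the preimage of [q i] under [weight_map] *)
pose z i := \sum_l dotE (dual_basis e l) (q i) *: tnth e l.
have phi_z (phi : 'Hom(E, (scalar_field R k)^o)) i : phi (z i) = dotE phi (q i).
  rewrite [in RHS](dual_basis_sum phi he) linear_sumlz linear_sum.
  by apply: eq_bigr => l _; rewrite linearZl_LR linearZ [LHS]mulrC.
(* Every linear form [psi] on [F] kills [del (z i)], because [psi \o del] lies in [im d] and [q i]
   is orthogonal to it. The coordinate forms suffice. *)
have del_z i : del (z i) = 0.
  rewrite (coord_vbasis (memvf (del (z i)))) big1 // => j _.
  pose psi : 'Hom(F, (scalar_field R k)^o) :=
    linfun (coord (vbasis {:F}) j : F -> (scalar_field R k)^o).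
  have : (psi \o del)%VF (z i) = 0.
    by rewrite phi_z dot_q_H // -transposeE memv_img ?memvf.
  by rewrite comp_lfunE lfunE /= => ->; rewrite scale0r.
have w_O l : w l \in orthov dotE H.
  apply/mem_orthovP => phi /memv_imgP[psi _ ->]; apply/eqP; rewrite herm_eq0C.
  apply/eqP; apply: etrans (dotw _ _) _.
  by rewrite transposeE comp_lfunE ker_projK linear0.
(* Since [z i] lies in the kernel, it is its own projection, hence the combination of the projected
   [e_l] with its own coordinates. Antilinearity of the weight map conjugates them. *)
pose Y : 'M[scalar_field R k]_s := \matrix_(i, l) sconj R k (coord e l (z i)).
have qE i : q i = \sum_l Y i l *: w l.
  apply: (@dot_nondegenerate _ _ _ dotE) => phi.
  rewrite -phi_z -(ker_proj_id hT (del_z i)).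
  rewrite {1}(coord_basis he (memvf (z i))) !linear_sum.
  apply: eq_bigr => l _; rewrite !linearZ /= mxE sconjK dotw.
  by rewrite (tnth_nth 0).
exists Y.
  apply/matrixP => i j; rewrite !mxE.
  transitivity (coord b j (q i)).
    rewrite linearB /=; congr (_ - _).
    rewrite (tnth_nth 0) coord_free ?normalized_dual_basis_free //.
    by rewrite eq_sym.
  by rewrite qE linear_sum; apply: eq_bigr => l _; rewrite linearZ !mxE.
move=> i l iT; rewrite mxE.
transitivity (dotE (q i) (w l)).
  rewrite qE linear_sumlz; apply: eq_bigr => j _.
  by rewrite linearZl_LR !mxE.
have -> : dotE (q i) (w l) = dotE (tnth b i) (w l).
  rewrite linearBl /= [X in _ - X](_ : _ = 0) ?subr0//.
  by apply/eqP; rewrite herm_eq0C (mem_orthovP (form := dotE) (w_O l)) // memv_pi.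
rewrite dotw tnth_mktuple scale_lfunE dual_basisE coord_ker_proj//.
by rewrite [LHS]mulr_natr.
Qed.

Local Open Scope classical_set_scope.
Local Open Scope ring_scope.

(** * The law of the random subset *)

Lemma prob_random_subset (d : measure_display) (Omega : measurableType d)
    (R : realType) (P : probability Omega R) (s : nat)
    (X : Omega -> {set 'I_s}) (Q : pred {set 'I_s}) : random_subset X ->
  prob P [set w | Q (X w)] = \sum_(A | Q A) prob P [set w | X w = A].
Proof.
move=> hX.
rewrite /prob sum_fine => [|A _]; last exact: fin_num_measure.
congr fine; rewrite -big_filter fsbig_seq; last first.
  by rewrite filter_uniq ?index_enum_uniq.
rewrite -measure_fin_bigcup //.
- congr (P _); apply/seteqP; split=> w /=.
    by move=> QX; exists (X w) => //=; rewrite mem_filter QX mem_index_enum.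
  by case=> A /=; rewrite mem_filter => /andP[QA _] ->.
- by move=> A B _ _ [w [/= <- <-]].
Qed.

Lemma weight_map0 (R : realType) (k : scalars) (s : nat)
    (E : vectType (scalar_field R k)) (e : s.-tuple E) (x : 'I_s -> R) :
  weight_map e x 0 = 0.
Proof. by apply: big1 => i _; rewrite linear0 rmorph0 scale0r. Qed.

Lemma prob_ge0 (d : measure_display) (Omega : measurableType d)
    (R : realType) (P : probability Omega R) (A : set Omega) : 0 <= prob P A.
Proof. exact: fine_ge0. Qed.

Lemma prob_subset_det (R : realType) (k : scalars) (s : nat)
    (V : vectType (scalar_field R k)) (dot : {dot V for sconj R k})
    (b : s.-tuple V) (H : {vspace V})
    (d : measure_display) (Omega : measurableType d) (P : probability Omega R)
    (X : Omega -> {set 'I_s}) (L : {set 'I_s}) :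
  random_subset X -> determinantal P dot b H X ->
  of_real k (prob P [set w | X w \subset L]) =
  \det (principal_submx (1%:M - mx_in_basis b (orth_proj dot H))^T (~: L)).
Proof.
move=> hX hdet; rewrite det_principal_submx_tr.
rewrite (prob_random_subset P (fun A : {set 'I_s} => A \subset L) hX) rmorph_sum.
apply: sum_subset_det => J; rewrite -hdet.
rewrite (prob_random_subset P (fun A : {set 'I_s} => J \subset A) hX).
by rewrite rmorph_sum.
Qed.

(** A proper subset of [T] misses some [t] in [T], so the event that [X] equals it is contained in a
    null event. *)
Lemma prob_eq_subset (d : measure_display) (Omega : measurableType d)
    (R : realType) (P : probability Omega R) (s : nat)
    (X : Omega -> {set 'I_s}) (T : {set 'I_s}) : random_subset X ->
  (forall t, t \in T -> prob P [set w | X w \subset (T :\ t)%SET] = 0) ->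
  prob P [set w | X w = T] = prob P [set w | X w \subset T].
Proof.
move=> hX hT; rewrite (prob_random_subset P (fun A : {set 'I_s} => A \subset T) hX).
rewrite (bigD1 T) //= big1 ?addr0 // => A /andP[AT AnT].
have /properP[_ [t tT tA]] : A \proper T by rewrite finset.properEneq AnT.
apply/eqP; rewrite eq_le prob_ge0 andbT -(hT t tT).
rewrite (prob_random_subset P (fun A : {set 'I_s} => A \subset (T :\ t)%SET) hX).
rewrite (bigD1 A) /= ?lerDl ?sumr_ge0 // => [B _|]; first exact: prob_ge0.
by rewrite finset.subsetD1 AT.
Qed.

(** * The conditional probability as a quotient of complementary minors *)

Theorem corollary13p9
  (R : realType) (k : scalars) (s : nat)
  (E F : vectType (scalar_field R k))
  (e : s.-tuple E) (he : basis_of {:E}%VS e)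
  (del : 'Hom(E, F))
  (x : 'I_s -> R) (hx : forall i : 'I_s, 0 < x i)
  (dotE : {dot 'Hom(E, (scalar_field R k)^o) for sconj R k})
  (hdotE : forall i j : 'I_s,
     inner dotE (dual_basis e i) (dual_basis e j) =
     if i == j then of_real k (x i) else 0)
  (d : measure_display) (Omega : measurableType d) (P : probability Omega R)
  (X : Omega -> {set 'I_s}) (hX : random_subset X)
  (hdet : determinantal P dotE (normalized_dual_basis e x)
            (limg (transpose del)) X)
  (L : {set 'I_s})
  (hL : exists2 T : {set 'I_s}, matroid_basis e del T & T \subset L) :
  0 < prob P [set w | X w \subset L] /\
  forall T : {set 'I_s}, matroid_basis e del T -> T \subset L ->
    of_real k (cond_prob P [set w | X w = T] [set w | X w \subset L]) =
    (of_real k (\prod_(i in L :\: T) x i))^-1 /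
    sqr_norm_family dotE e x (ker_family e del L T).
Proof.
pose c i := of_real k (x i).
have c0 i : c i != 0 by rewrite fmorph_eq0 gt_eqF.
(* The factor [g] is the Gram determinant over [~: T]. It is common to both identities and will
   cancel in the quotient. *)
have key (T : {set 'I_s}) : matroid_basis e del T -> T \subset L ->
    [/\ prob P [set w | X w = T] = prob P [set w | X w \subset T],
        0 < prob P [set w | X w = T] &
        exists2 g, g != 0 &
          of_real k (prob P [set w | X w \subset T]) * g =
            \prod_(i in ~: T) (c i)^-1 /\
          of_real k (prob P [set w | X w \subset L]) * g =
            \prod_(i in ~: L) (c i)^-1 *
            sqr_norm_family dotE e x (ker_family e del L T)].
  move=> hT TL.
  have [Y QYB YG] := compl_proj_factor he hx hdotE hT.
  have w0 l : l \in T -> weight_map e x (ker_proj e del T (tnth e l)) = 0.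
    by move=> lT; rewrite ker_proj_basis0 // weight_map0.
  have subE := prob_subset_det _ hX hdet.
  move: QYB YG; set B := \matrix_(l, i) _; set G := \matrix_(l, j) _ => QYB YG.
  have BT l i : l \in T -> B l i = 0 by move=> lT; rewrite mxE w0 // linear0.
  have GT l i : l \in T -> G l i = 0 by move=> lT; rewrite mxE w0 // linear0l.
  (* The factor [x_i^-1] of the weight map meets the square root of [x_i] coming from the normalized
     basis. *)
  have Bd l i : i \notin T -> B l i = (of_real k (Num.sqrt (x i)))^-1 *+ (l == i).
    move=> iT; rewrite mxE coord_normalized_dual_basis // weight_map_tnth //.
    rewrite coord_ker_proj // rmorph_nat -mulrA eq_sym.
    rewrite -{1}(sqr_sqrtr (ltW (hx i))) rmorphXn expr2 invfM mulfVK.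
      by rewrite mulr_natl.
    exact: of_real_sqrt_neq0.
  have dE (J : {set 'I_s}) :
      \prod_(i in J) (of_real k (Num.sqrt (x i)))^-1 ^+ 2 = \prod_(i in J) (c i)^-1.
    by apply: eq_bigr => i _; rewrite exprVn -rmorphXn sqr_sqrtr ?ltW.
  have normE : \det (principal_submx G (L :\: T)) =
      sqr_norm_family dotE e x (ker_family e del L T).
    rewrite /sqr_norm_family.
    rewrite (det_matrix_map_enum 0 (fun j => ker_proj e del T (tnth e j))
      (fun u v => inner dotE (weight_map e x u) (weight_map e x v))).
    (* The transpose accounts for [inner] swapping the arguments of the dot product. *)
    rewrite -det_principal_submx_tr; congr (\det _).
    by apply: eq_principal_submx => i j _ _; rewrite !mxE.
  have idT := minor_identity (subxx T) QYB Bd GT YG.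
  have idL := minor_identity TL QYB Bd GT YG.
  rewrite -!subE !dE normE in idT idL.
  (* The probability of being contained in [T :\ t] is a minor of size larger than [#|~: T|], so it
     vanishes. *)
  have eqT : prob P [set w | X w = T] = prob P [set w | X w \subset T].
    apply: prob_eq_subset => // t tT; apply: (fmorph_inj (of_real k)).
    rewrite rmorph0 subE QYB; apply: (@det_principal_submx_mul_eq0 _ _ _ _ T) => //.
    apply: proper_card; apply/properP; rewrite finset.setCS finset.subD1set.
    by split => //; exists t; rewrite !inE ?tT ?eqxx.
  have prodT : \prod_(i in ~: T) (c i)^-1 != 0.
    by apply/prodf_neq0 => i _; rewrite invr_eq0.
  have det0 : \det (principal_submx G (T :\: T)) = 1.
    rewrite finset.setDv (det_principal_submx_mask G) -[RHS](det1 _ s).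
    by congr (\det _); apply/matrixP => i j; rewrite !mxE finset.in_set0.
  rewrite det0 mulr1 in idT.
  (* By [idT] this product is a product of inverse weights, so both factors are nonzero at once. *)
  have : of_real k (prob P [set w | X w \subset T]) *
      \det (principal_submx G (~: T)) != 0 by rewrite idT.
  rewrite mulf_eq0 negb_or => /andP[PT0 G0]; split => //.
    by rewrite eqT lt_def prob_ge0 andbT; rewrite fmorph_eq0 in PT0.
  by exists (\det (principal_submx G (~: T))).
have PL0 : 0 < prob P [set w | X w \subset L].
  have [T hT TL] := hL; have [eqT PT0 _] := key T hT TL.
  apply: lt_le_trans PT0 _.
  rewrite (prob_random_subset P (fun A : {set 'I_s} => A \subset L) hX).
  by rewrite (bigD1 T) //= lerDl sumr_ge0 // => A _; exact: prob_ge0.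
split=> // T hT TL; have [eqT _ [g g0 [idT idL]]] := key T hT TL.
have -> : cond_prob P [set w | X w = T] [set w | X w \subset L] =
    prob P [set w | X w \subset T] / prob P [set w | X w \subset L].
  rewrite /cond_prob -eqT; congr (prob P _ / _).
  by apply/seteqP; split=> w /= => [[]//|wT]; rewrite wT.
rewrite fmorph_div; set a := of_real k _ in idT *; set l := of_real k _ in idL *.
have l0 : l != 0 by rewrite fmorph_eq0 gt_eqF.
have -> : a / l = (a * g) / (l * g) by rewrite -mulf_div divff // mulr1.
set n := sqr_norm_family _ _ _ _ in idL *.
(* The complement of [T] splits into [~: L] and [L :\: T]. The first part cancels and the second
   leaves the weight factor of the conclusion. *)
have TE : \prod_(i in ~: T) (c i)^-1 =
    \prod_(i in ~: L) (c i)^-1 * (of_real k (\prod_(i in L :\: T) x i))^-1.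
  rewrite rmorph_prod -prodfV (bigID (mem L)) /= mulrC; congr (_ * _).
    apply: eq_bigl => i; rewrite !inE.
    case: (boolP (i \in L)) => iL; rewrite ?andbF ?andbT //.
    by apply: contra iL; apply: (fintype.subsetP TL).
  by apply: eq_bigl => i; rewrite !inE.
rewrite idT idL TE -mulf_div divff ?mul1r //.
by apply/prodf_neq0 => i _; rewrite invr_eq0.
Qed.
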